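(* $F_e(K_3,J_4;5)\le 27$; that is, there exists a $K_5$-free graph $G$ on 27 vertices such that every red-blue coloring of $E(G)$ contains a red $K_3$ or a blue $J_4$.
   Context: All graphs are finite and simple. $J_4$ denotes $K_4$ with one edge removed. $G\rightarrow(H_1,H_2)^e$ means: for every coloring of $E(G)$ with colors 1, 2 there is $i$ such that the subgraph formed by the edges of color $i$ contains a (not necessarily induced) copy of $H_i$. The edge Folkman number $F_e(H_1,H_2;k)$ is the minimum number of vertices of a $K_k$-free graph $G$ with $G\rightarrow(H_1,H_2)^e$. *)

(* Defs.v *)
From mathcomp Require Import all_boot.
Set Implicit Arguments. Unset Strict Implicit. Unset Printing Implicit Defensive.

Definition simple_graph (T : finType) (e : rel T) : Prop :=
  (forall x y, e x y = e y x) /\ (forall x, e x x = false).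

Definition contains_copy (T : finType) (e : rel T) (n : nat) (H : rel 'I_n) : Prop :=
  exists f : 'I_n -> T, injective f /\ (forall i j, H i j -> e (f i) (f j)).

Arguments contains_copy {T} e {n} H.

Definition Kn (n : nat) : rel 'I_n := fun i j => i != j.
Arguments Kn n : clear implicits.

(* J_4 = K_4 minus the edge {2,3}, on vertex set 'I_4. *)
Definition J4 : rel 'I_4 := fun i j => (i != j) && ((val i < 2) || (val j < 2)).

Definition Kfree (T : finType) (e : rel T) (k : nat) : Prop :=
  ~ contains_copy e (Kn k).

Arguments Kfree {T} e k.

(* G -> (H1,H2)^e : every 2-colouring of E(G) (colour true = 1 = red,
   false = 2 = blue; a colouring is a symmetric function on pairs, only its
   values on edges matter) has a colour-1 copy of H1 or a colour-2 copy of H2. *)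
Definition edge_arrows (T : finType) (e : rel T)
    (n1 : nat) (H1 : rel 'I_n1) (n2 : nat) (H2 : rel 'I_n2) : Prop :=
  forall c : T -> T -> bool, (forall x y, c x y = c y x) ->
    contains_copy (fun x y => e x y && c x y) H1 \/
    contains_copy (fun x y => e x y && ~~ c x y) H2.

Arguments edge_arrows {T} e {n1} H1 {n2} H2.

(* Main.v *)
(** The graph is a cone [K_1 + H] with apex [z].  Colouring the edges at [z] splits
    [V(H)] into a red part and a blue part.  If the red part contains a [J_4], then
    a red edge of it closes a red triangle with [z], and otherwise it is a blue
    [J_4].  If the blue part contains a wheel [K_1 + C_4], then two blue edges
    of the wheel sharing an endpoint [u] form a blue [J_4] with [u] and [z] as hubs;
    so at most one spoke is blue, hence three consecutive spokes are red, and the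
    two rim edges between them must be blue (or close a red triangle), but they
    share an endpoint.  It remains to find a [K_4]-free [H] on 26 vertices such that
    each bipartition of [V(H)] has a [J_4] in the first part or a wheel in the second:
    [H] is obtained from a 14-vertex [K_4]-free graph, each of whose vertex
    bipartitions has a triangle in some part, by doubling all but two vertices. *)
Require Import Defs.
From mathcomp Require Import all_boot.
Set Implicit Arguments. Unset Strict Implicit. Unset Printing Implicit Defensive.

Fixpoint has_clique (T : Type) (e : rel T) (k : nat) (s : seq T) : bool :=
  if k is k'.+1 then has (fun x => has_clique e k' (filter (e x) s)) s else true.

Lemma has_cliqueP (T : eqType) (e : rel T) (k : nat) (s : seq T) (f : 'I_k -> T) :
  (forall i j, i != j -> e (f i) (f j)) -> (forall i, f i \in s) ->
  has_clique e k s.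
Proof.
elim: k s f => [//|k IHk] s f ef sf /=.
apply/hasP; exists (f ord0) => //.
apply: (IHk _ (fun i => f (lift ord0 i))) => [i j ij|i].
  by apply: ef; rewrite (inj_eq lift_inj).
by rewrite mem_filter ef ?sf.
Qed.

Definition has_J4 (T : Type) (e : rel T) (s : seq T) : bool :=
  has (fun a => let na := filter (e a) s in has (fun b => 1 < count (e b) na) na) s.

(** [a] and [b] are opposite corners of the cycle; any two common neighbours are the other two. The
    cycle need not be induced. *)
Definition has_C4 (T : eqType) (e : rel T) (s : seq T) : bool :=
  has (fun a => let na := filter (e a) s in
                has (fun b => (a != b) && (1 < count (e b) na)) s) s.

Definition has_wheel (T : eqType) (e : rel T) (s : seq T) : bool :=
  has (fun v => has_C4 e (filter (e v) s)) s.

(* [if] rather than [||] because [vm_compute] evaluates both arguments of [||]. *)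
Fixpoint every_split (T : Type) (p q : pred (seq T)) (s r b : seq T) : bool :=
  if s is x :: s' then
    (if p (x :: r) then true else every_split p q s' (x :: r) b) &&
    (if q (x :: b) then true else every_split p q s' r (x :: b))
  else false.

(** Follow the branch that sends an element satisfying [c] to [r] and any other to [b]. The search
    fails on an empty list, so success forces a hit of [p] or [q] on this branch. [uniq t] later
    makes counted neighbours distinct. *)
Lemma every_splitP (T : eqType) (p q : pred (seq T)) (s r b : seq T) (c d : pred T) :
  every_split p q s r b -> uniq (s ++ r) -> uniq (s ++ b) ->
  all (predU c d) s -> all c r -> all d b ->
  exists2 t, uniq t & p t && all c t || q t && all d t.
Proof.
elim: s r b => //= x s IHs r b /andP[Sr Sb] ur ub /andP[/orP[cx|dx] cds] cr db.
  have {}ur : uniq (s ++ x :: r) by rewrite -cat1s uniq_catCA.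
  case: ifP Sr => [pr _|_ Sr].
    exists (x :: r); last by rewrite pr /= cx cr.
    by move: ur; rewrite cat_uniq => /and3P[].
  by apply: (IHs (x :: r) b) => //=; [case/andP: ub | rewrite cx].
have {}ub : uniq (s ++ x :: b) by rewrite -cat1s uniq_catCA.
case: ifP Sb => [qb _|_ Sb].
  exists (x :: b); last by rewrite qb /= dx db orbT.
  by move: ub; rewrite cat_uniq => /and3P[].
by apply: (IHs r (x :: b)) => //=; [case/andP: ur | rewrite dx].
Qed.

Lemma count_gt1P (T : eqType) (p : pred T) (s : seq T) :
  uniq s -> 1 < count p s ->
  exists x y, [/\ x != y, x \in s, y \in s, p x & p y].
Proof.
move=> us; rewrite -size_filter.
case E: (filter p s) => [|x [|y t]] // _.
have: uniq [:: x, y & t] by rewrite -E filter_uniq.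
rewrite /= inE negb_or => /andP[/andP[xy _] _].
have: x \in filter p s by rewrite E inE eqxx.
have: y \in filter p s by rewrite E !inE eqxx orbT.
by rewrite !mem_filter => /andP[py sy] /andP[px sx]; exists x, y.
Qed.

Section Copies.

Variables (T : finType) (g : rel T).
Hypotheses (g_sym : symmetric g) (g_irr : irreflexive g).

Lemma adj_neq x y : g x y -> x != y.
Proof. by apply: contraTneq => ->; rewrite g_irr. Qed.

Lemma copy_K3 x y z : g x y -> g y z -> g x z -> contains_copy g (Kn 3).
Proof.
move=> xy yz xz; pose f := tnth [tuple x; y; z].
have gf i j : i != j -> g (f i) (f j).
  by case: i j => [[|[|[|i]]] //= lti] [[|[|[|j]]] //= ltj];
     rewrite /f !(tnth_nth x) /= // g_sym.
exists f; split=> // i j /eqP; apply: contraTeq => /gf/adj_neq; exact.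
Qed.

Lemma copy_J4 a b x y : x != y -> g a b -> g a x -> g a y -> g b x -> g b y ->
  contains_copy g J4.
Proof.
move=> xy ab ax ay bx by_; pose f := tnth [tuple a; b; x; y].
exists f; split.
  apply/tuple_uniqP; rewrite /= !inE !negb_or xy (adj_neq ab).
  by rewrite (adj_neq ax) (adj_neq ay) (adj_neq bx) (adj_neq by_).
move=> i j; rewrite /J4.
by case: i j => [[|[|[|[|i]]]] //= lti] [[|[|[|[|j]]]] //= ltj];
   rewrite /f !(tnth_nth a) /= // g_sym.
Qed.

End Copies.

Section Cone.

Variables (T : finType) (e c : rel T) (z : T).
Hypotheses (e_sym : symmetric e) (e_irr : irreflexive e) (c_sym : symmetric c).

Let red x y := e x y && c x y.
Let blue x y := e x y && ~~ c x y.
Let mono := contains_copy red (Kn 3) \/ contains_copy blue J4.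

Lemma red_triangle u v w : e u v -> e v w -> e u w -> c u v -> c v w -> c u w -> mono.
Proof.
move=> uv vw uw cuv cvw cuw; left.
apply: (@copy_K3 _ red _ _ u v w); rewrite /red ?uv ?vw ?uw //.
  by move=> x y; rewrite e_sym c_sym.
by move=> x; rewrite e_irr.
Qed.

Lemma blue_hubs a b x y : x != y -> e a b -> e a x -> e a y -> e b x -> e b y ->
  ~~ c a b -> ~~ c a x -> ~~ c a y -> ~~ c b x -> ~~ c b y -> mono.
Proof.
move=> xy ab ax ay bx by_ nab nax nay nbx nby; right.
apply: (@copy_J4 _ blue _ _ a b x y); rewrite /blue ?ab ?ax ?ay ?bx ?by_ //.
  by move=> u v; rewrite e_sym c_sym.
by move=> u; rewrite e_irr.
Qed.

Lemma red_part s : uniq s -> has_J4 e s -> all (red z) s -> mono.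
Proof.
move=> us /hasP[a sa /= /hasP[b]]; rewrite mem_filter => /andP[ab sb].
case/(count_gt1P (filter_uniq _ us)) => x [y [xy]]; rewrite !mem_filter.
move=> /andP[ax sx] /andP[ay sy] bx by_ /allP rz.
have blue_edge u v : u \in s -> v \in s -> e u v -> mono \/ ~~ c u v.
  move=> su sv uv; case cuv: (c u v); [left|by right].
  by case/andP: (rz u su) (rz v sv) => zu czu /andP[zv czv]; apply: (@red_triangle z u v).
have [//|nab] := blue_edge _ _ sa sb ab.
have [//|nax] := blue_edge _ _ sa sx ax.
have [//|nay] := blue_edge _ _ sa sy ay.
have [//|nbx] := blue_edge _ _ sb sx bx.
have [//|nby] := blue_edge _ _ sb sy by_.
exact: (@blue_hubs a b x y).
Qed.

Lemma blue_part s : uniq s -> has_wheel e s -> all (blue z) s -> mono.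
Proof.
move=> us /hasP[v sv /hasP[a]]; rewrite mem_filter => /andP[va sa].
case/hasP=> b; rewrite mem_filter => /andP[vb sb] /andP[ab].
case/(count_gt1P (filter_uniq _ (filter_uniq _ us))) => x [y [xy]]; rewrite !mem_filter.
move=> /and3P[ax vx sx] /and3P[ay vy sy] bx by_ /allP bz.
(* Two blue edges at [u]: together with [z] as the second hub they form a blue [J4]. *)
have cherry u p q : u \in s -> p \in s -> q \in s -> p != q ->
    e u p -> e u q -> c u p = false -> c u q = false -> mono.
  move=> su sp sq pq up uq /negbT cup /negbT cuq.
  case/andP: (bz u su) (bz p sp) (bz q sq) => zu czu /andP[zp czp] /andP[zq czq].
  exact: (@blue_hubs z u p q).
have fan p m q : p \in s -> m \in s -> q \in s -> p != q -> e v p -> e v m -> e v q ->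
    e p m -> e q m -> c v p -> c v m -> c v q -> mono.
  move=> sp sm sq pq vp vm vq pm qm cp cm cq.
  case cpm: (c p m); first exact: (@red_triangle v p m).
  case cqm: (c q m); first exact: (@red_triangle v q m).
  by apply: (cherry m p q); rewrite // 1?e_sym 1?c_sym.
have [xa xb ya yb] : [/\ e x a, e x b, e y a & e y b] by split; rewrite e_sym.
have nadj := adj_neq e_irr.
(* The rim is the cycle [a], [x], [b], [y]. Either three consecutive spokes are red, which [fan]
   settles, or two spokes are blue, which [cherry] settles. *)
case cva: (c v a); case cvb: (c v b); case cvx: (c v x); case cvy: (c v y);
  first [ by apply: (fan a x b) | by apply: (fan a y b)
        | by apply: (fan x a y) | by apply: (fan x b y)
        | by apply: (cherry v a b) | by apply: (cherry v x y)
        | by apply: (cherry v a x); rewrite ?nadj | by apply: (cherry v a y); rewrite ?nadj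
        | by apply: (cherry v b x); rewrite ?nadj | by apply: (cherry v b y); rewrite ?nadj ].
Qed.

End Cone.

(* [ord_enum] does not compute: [insub] is stuck on the opaque [idP]. *)
Definition ords (n : nat) : seq 'I_n := pmap (insub_eq _) (iota 0 n).

Lemma ordsE (n : nat) : ords n = ord_enum n.
Proof. by apply: eq_pmap => i; rewrite insub_eqE. Qed.

Lemma mem_ords (n : nat) (i : 'I_n) : i \in ords n.
Proof. by rewrite ordsE mem_ord_enum. Qed.

(* The vertices [0..6] induce the square of a 7-cycle and [7..13] a 7-cycle; the
   graph comes from a computer search among those invariant under [Z/7]. *)
Definition base (p q : nat) : bool :=
  if p < 7 then
    if q < 7 then (p + 14 - q) %% 7 \in [:: 1; 2; 5; 6]
    else (p + 14 - q) %% 7 \in [:: 0; 2; 3; 5]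
  else
    if q < 7 then (q + 14 - p) %% 7 \in [:: 0; 2; 3; 5]
    else (p + 14 - q) %% 7 \in [:: 1; 6].

(** Vertices [2k] and [2k+1] are nonadjacent twins over [k < 12]; 24 and 25 are the single copies of
    12 and 13, and 26 is left for the apex. *)
Definition base_of (i : nat) : nat := if i < 24 then i./2 else i - 12.

Definition adjacent (x y : nat) : bool :=
  if (x == 26) || (y == 26) then x != y else base (base_of x) (base_of y).

(* Tabulated, so that the exhaustive search below is fast. *)
Definition adjacency : seq (seq bool) :=
  Eval vm_compute in mkseq (fun x => mkseq (adjacent x) 27) 27.

Definition cone : rel 'I_27 := fun x y => nth false (nth [::] adjacency x) y.

Definition apex : 'I_27 := ord_max.

Lemma cone_sym : symmetric cone.
Proof.
have /allP H : all (fun x => all (fun y => cone x y == cone y x) (ords 27)) (ords 27).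
  by vm_compute.
by move=> x y; have /allP/(_ y (mem_ords y))/eqP := H x (mem_ords x).
Qed.

Lemma cone_irr : irreflexive cone.
Proof.
have /allP H : all (fun x => ~~ cone x x) (ords 27) by vm_compute.
by move=> x; apply/negbTE/H/mem_ords.
Qed.

Lemma cone_K5free : Kfree cone 5.
Proof.
case=> f [_ ef].
have := has_cliqueP ef (fun i => mem_ords (f i)).
by apply/negP; vm_compute.
Qed.

(** [take 26] drops the apex, which is the last vertex. *)
Lemma cone_every_split :
  every_split (has_J4 cone) (has_wheel cone) (take 26 (ords 27)) [::] [::].
Proof. by vm_compute. Qed.

Theorem theorem11 :
  exists e : rel 'I_27,
    simple_graph e /\ Kfree e 5 /\ edge_arrows e (Kn 3) J4.
Proof.
exists cone; split; first by split; [exact: cone_sym | exact: cone_irr].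
split; first exact: cone_K5free.
move=> c c_sym.
set s := take 26 (ords 27).
have us : uniq (s ++ [::]) by rewrite cats0 take_uniq // ordsE ord_enum_uniq.
(* The apex is adjacent to every other vertex, so the colours of its edges split all of [s]. *)
have zs : all (predU (fun x => cone apex x && c apex x)
                     (fun x => cone apex x && ~~ c apex x)) s.
  have /allP zs : all (cone apex) s by vm_compute.
  by apply/allP => x /zs /= ->; case: (c apex x).
have [t ut] := every_splitP cone_every_split us us zs isT isT.
case/orP=> /andP[Ht ct].
  exact (red_part cone_sym cone_irr c_sym ut Ht ct).
exact (blue_part cone_sym cone_irr c_sym ut Ht ct).
Qed.
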